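(* There exist non-sequenceable envy-free allocations, even if the agents' preferences are strict on shares: there exist an add-MARA instance $I=(\mathcal{A},\mathcal{O},W)$ whose preferences are strict on shares and an allocation $\pi$ of $I$ such that $\pi$ is envy-free and $\pi$ is not sequenceable.
   Context: An add-MARA instance is a triple $I=(\mathcal{A},\mathcal{O},W)$ where $\mathcal{A}=\{1,\dots,N\}$ is a nonempty finite set of agents, $\mathcal{O}=\{1,\dots,M\}$ is a nonempty finite set of objects, and $W:\mathcal{A}\times\mathcal{O}\to\mathbb{R}_{\ge 0}$ gives the weight $W(i,\ell)$ of object $\ell$ for agent $i$. The utility of agent $i$ for a share $S\subseteq\mathcal{O}$ is $u_i(S)=\sum_{\ell\in S}W(i,\ell)$. Preferences are strict on shares if for each agent $i$ and all shares $S\neq S'$, $u_i(S)\neq u_i(S')$. An allocation is a vector $\pi=\langle\pi_1,\dots,\pi_N\rangle$ of pairwise disjoint (possibly empty) subsets of $\mathcal{O}$ with $\bigcup_i\pi_i=\mathcal{O}$. An allocation $\pi$ is envy-free if $u_i(\pi_i)\ge u_i(\pi_j)$ for all agents $i,j$. For $O\subseteq\mathcal{O}$ and an agent $i$, $\mathrm{best}(O,i)=\operatorname{argmax}_{\ell\in O}W(i,\ell)\subseteq O$ is the set of all objects of $O$ of maximal weight for $i$. A sequence of sincere choices is a vector $\sigma=(\sigma_1,\dots,\sigma_M)\in\mathcal{A}^M$. The sequence $\sigma$ generates $\pi$ if there are objects $o_1,\dots,o_M$ such that, with $\mathcal{O}_1=\mathcal{O}$ and $\mathcal{O}_{t+1}=\mathcal{O}_t\setminus\{o_t\}$,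 one has $o_t\in\mathrm{best}(\mathcal{O}_t,\sigma_t)$ for $t=1,\dots,M$, and $\pi_i=\{o_t:\sigma_t=i\}$ for every agent $i$. An allocation is sequenceable if some sequence of sincere choices generates it. *)

(* Defs.v *)
From mathcomp Require Import all_boot all_order all_algebra.
From mathcomp Require Import reals.

Set Implicit Arguments.
Unset Strict Implicit.
Unset Printing Implicit Defensive.

Import Order.TTheory GRing.Theory Num.Theory.
Local Open Scope ring_scope.

(* Agents, objects and time steps are numbered from 0 instead of from 1. *)
Record addMARA (R : realType) := AddMARA {
  nagents : nat;
  nobjects : nat;
  weight : 'I_nagents -> 'I_nobjects -> R;
  nagents_gt0 : (0 < nagents)%N;
  nobjects_gt0 : (0 < nobjects)%N;
  weight_ge0 : forall i l, 0 <= weight i l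
}.

Notation agent I := 'I_(nagents I).
Notation object I := 'I_(nobjects I).
Notation share I := {set object I}.

Definition utility (R : realType) (I : addMARA R) (i : agent I) (S : share I)
    : R :=
  \sum_(l in S) weight i l.

Definition strict_on_shares (R : realType) (I : addMARA R) : Prop :=
  forall (i : agent I) (S S' : share I), S <> S' -> utility i S <> utility i S'.

Record allocation (R : realType) (I : addMARA R) := Allocation {
  share_of :> agent I -> share I;
  share_disjoint : forall i j, i != j -> [disjoint share_of i & share_of j];
  share_cover : \bigcup_(i : agent I) share_of i = [set: object I]
}.

Definition envy_free (R : realType) (I : addMARA R) (p : allocation I) : Prop :=
  forall i j : agent I, utility i (p j) <= utility i (p i).

Definition best (R : realType) (I : addMARA R) (O : share I) (i : agent I)
    : share I :=
  [set l in O | [forall k in O, weight i k <= weight i l]].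

(* One agent per object: time steps range over the same ordinals as objects. *)
Definition sincere_sequence (R : realType) (I : addMARA R) : Type :=
  (nobjects I).-tuple (agent I).

(* [avail t] is the set of objects still available before step [t]; its values
   beyond [nobjects I] are unconstrained and irrelevant. *)
Definition generates (R : realType) (I : addMARA R)
    (s : sincere_sequence I) (p : allocation I) : Prop :=
  exists (o : (nobjects I).-tuple (object I)) (avail : nat -> share I),
    [/\ avail 0%N = [set: object I],
        forall t : 'I_(nobjects I), avail t.+1 = avail t :\ tnth o t,
        forall t : 'I_(nobjects I), tnth o t \in best (avail t) (tnth s t)
      & forall i : agent I,
          p i = [set tnth o t | t : 'I_(nobjects I) & tnth s t == i]].

Definition sequenceable (R : realType) (I : addMARA R) (p : allocation I)
    : Prop :=
  exists s : sincere_sequence I, generates s p.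

(* Main.v *)
(** Two agents and four objects suffice. The weights 3, 5, 6, 7 have pairwise
    distinct subset sums and satisfy 3 + 7 < 5 + 6. So an agent who values the
    objects of her own share at 5 and 6, and those of the other share at 3 and
    7, is not envious although her most preferred object is in the other share.
    When this holds for both agents, no agent can make the first choice. *)

Require Import Defs.
From mathcomp Require Import all_boot all_order all_algebra.
From mathcomp Require Import reals.

Import Order.TTheory GRing.Theory Num.Theory.

(** Natural numbers let computation settle the finite checks; the cast to [R] comes only in
    [swap_instance]. The second row is the first rotated by two places, which exchanges the roles of
    the two shares. *)
Definition swap_weight (i : 'I_2) (l : 'I_4) : nat :=
  nth 0 (if i == ord0 then [:: 5; 6; 7; 3] else [:: 7; 3; 5; 6]) l.

Definition swap_sum (i : 'I_2) (S : {set 'I_4}) : nat :=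
  \sum_(l in S) swap_weight i l.

Definition swap_share (i : 'I_2) : {set 'I_4} :=
  [set l : 'I_4 | (l < 2) == (i == ord0)].

Lemma swap_sum_inj (i : 'I_2) : injective (swap_sum i).
Proof.
move=> S S'; rewrite /swap_sum [LHS]big_mkcond [RHS]big_mkcond !big_ord_recl !big_ord0.
(* These are the forms that [big_ord_recl] gives to the four objects, so the memberships in the goal
   and in [eqS] agree syntactically. *)
set x0 : 'I_4 := ord0; set x1 := @lift 4 ord0 ord0.
set x2 := @lift 4 ord0 (@lift 3 ord0 ord0).
set x3 := @lift 4 ord0 (@lift 3 ord0 (@lift 2 ord0 ord0)) => eqS; apply/setP => l.
have /or4P[] : [|| l == x0, l == x1, l == x2 | l == x3].
  by case: l => -[|[|[|[|]]]].
all: move=> /eqP ->; move: eqS; rewrite /swap_weight; case: (i == ord0) => /=.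
(* Eight booleans: the membership of each of the four objects in [S] and in [S']. *)
all: by do 8!case: (_ \in _).
Qed.

Lemma swap_sum_envy_free (i j : 'I_2) :
  swap_sum i (swap_share j) <= swap_sum i (swap_share i).
Proof.
rewrite /swap_sum [leqLHS]big_mkcond [leqRHS]big_mkcond.
rewrite !big_ord_recl !big_ord0 !inE.
by case: i j => -[|[|//]] ? [[|[|//]]] ?.
Qed.

Lemma swap_share_top (i : 'I_2) (l : 'I_4) :
  (forall k, swap_weight i k <= swap_weight i l) -> l \notin swap_share i.
Proof.
(* Object 2 has weight 7 for agent 0, and object 0 for agent 1; each beats the 5 and 6 in the
   agent's own share. *)
move=> top; have := top (inord 0); have := top (inord 2).
rewrite /swap_weight !inordK // inE.
by case: i l {top} => -[|[|//]] ? [[|[|[|[|//]]]]] ?.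
Qed.

Lemma swap_share_disjoint (i j : 'I_2) :
  i != j -> [disjoint swap_share i & swap_share j].
Proof.
move=> neq_ij; rewrite -setI_eq0; apply/eqP/setP => l; rewrite !inE.
by case: i j neq_ij => -[|[|//]] ? [[|[|//]]] ?; case: (l < 2).
Qed.

Lemma swap_share_cover : \bigcup_(i : 'I_2) swap_share i = [set: 'I_4].
Proof.
apply/setP => l; rewrite big_ord_recl big_ord1 !inE.
by case: (l < 2).
Qed.

Local Open Scope ring_scope.

Definition swap_instance (R : realType) : addMARA R :=
  @AddMARA R 2 4 (fun i l => (swap_weight i l)%:R) isT isT
    (fun i l => ler0n R (swap_weight i l)).

Definition swap_allocation (R : realType) : allocation (swap_instance R) :=
  @Allocation R (swap_instance R) swap_share
    swap_share_disjoint swap_share_cover.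

Lemma swap_utility (R : realType) (i : 'I_2) (S : {set 'I_4}) :
  @utility R (swap_instance R) i S = (swap_sum i S)%:R.
Proof. by rewrite /utility /swap_sum natr_sum. Qed.

Theorem proposition8 (R : realType) :
  exists I : addMARA R, strict_on_shares I /\
    exists p : allocation I, envy_free p /\ ~ sequenceable p.
Proof.
exists (swap_instance R); split=> [i S S' neqS|].
  by rewrite !swap_utility => /eqP; rewrite eqr_nat => /eqP /swap_sum_inj.
exists (swap_allocation R); split=> [i j|[s [o [avail [avail0 _ sincere gen]]]]].
  by rewrite !swap_utility ler_nat swap_sum_envy_free.
(* At step [t0] all objects are available, so the pick of [i] has maximal weight among all of them,
   yet by [gen] it lies in the share of [i]. *)
pose t0 : 'I_4 := ord0; pose i := tnth s t0.
have own : tnth o t0 \in swap_share i.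
  by rewrite -[swap_share i]/(swap_allocation R i) gen; apply: imset_f; rewrite inE.
have := sincere t0; rewrite avail0 inE => /andP[_ /forallP top].
move: own; apply/negP/swap_share_top => k.
by have := top k; rewrite inE ler_nat.
Qed.
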